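(* Let $\mathbb K$ be a triangulation (finite or infinite, with or without boundary) of a disc in $\mathbb C$, let $\mathcal P$ be a circle packing for $\mathbb K$, possibly branched and with prescribed angles of overlaps, and let $(\mathbb K,p_{\mathcal P})$ be the random walk induced by $\mathcal P$. For $v\in\mathbb K^0$ let $S_{\mathcal P}(v)\in\mathbb C$ be the center of the circle $C_{\mathcal P}(v)$ of $\mathcal P$ corresponding to $v$. Then both functions $\Re_{\mathcal P},\Im_{\mathcal P}:\mathbb K^0\to\mathbb R$, $\Re_{\mathcal P}(v):=\mathrm{Re}(S_{\mathcal P}(v))$ and $\Im_{\mathcal P}(v):=\mathrm{Im}(S_{\mathcal P}(v))$, are harmonic for $(\mathbb K,p_{\mathcal P})$.
   Context: $\mathbb K$ is a simplicial $2$-complex triangulating a disc in $\mathbb C$, oriented by the orientation of $\mathbb C$; $\mathbb K^0$ and $\mathbb K^1$ are its vertex set and edge set, $\mathrm{int}\,\mathbb K^0$ is the set of interior (non-boundary) vertices, and $u\sim v$ means $uv\in\mathbb K^1$. A circle packing for $\mathbb K$, possibly branched and with prescribed angles of overlaps, is a collection $\mathcal P=\{C_{\mathcal P}(v)\}_{v\in\mathbb K^0}$ of Euclidean circles in $\mathbb C$, with centers $S_{\mathcal P}(v)$ and positive finite radii $r_{\mathcal P}(v)$, such that for every edge $uv$ the circles $C_{\mathcal P}(u)$ and $C_{\mathcal P}(v)$ overlap at the angle $\theta(uv)$ prescribed for that edge, i.e. $|S_{\mathcal P}(u)-S_{\mathcal P}(v)|^2=r_{\mathcal P}(u)^2+r_{\mathcal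 P}(v)^2+2r_{\mathcal P}(u)r_{\mathcal P}(v)\cos\theta(uv)$ (so $\theta(uv)=0$ means external tangency), and for every positively oriented face $(u,v,w)$ of $\mathbb K$ the centers $S_{\mathcal P}(u),S_{\mathcal P}(v),S_{\mathcal P}(w)$ form a positively oriented non-degenerate triangle. No global or local disjointness is required: the triangles around an interior vertex may wrap around its image more than once (branching). The radical center of three circles with non-collinear centers is the unique point having equal power with respect to all three circles (the power of $z$ with respect to the circle with center $a$ and radius $r$ is $|z-a|^2-r^2$). Edge conductances: if $u\sim v$ and at least one of $u,v$ is an interior vertex, there are exactly two faces of $\mathbb K$ containing the edge $uv$; let $w',w''$ be their third vertices, and let $z'$ and $z''$ be the radical centers of the triples $C_{\mathcal P}(u),C_{\mathcal P}(v),C_{\mathcal P}(w')$ and $C_{\mathcal P}(u),C_{\mathcal P}(v),C_{\mathcal P}(w'')$, respectively. Set $$c_{\mathcal P}(u,v):=\frac{|z'-z''|}{|S_{\mathcal P}(u)-S_{\mathcal P}(v)|}.$$ The random walk $(\mathbb K,p_{\mathcal P})$ induced by $\mathcal P$ has transition probabilities $p_{\mathcal P}(u,v)$ (from $u$ to $v$): if $u\in\mathrm{int}\,\mathbb K^0$, then $p_{\mathcal P}(u,v)=c_{\mathcal P}(u,v)/\sum_{w\sim u}c_{\mathcal P}(u,w)$ when $v\sim u$, and $p_{\mathcal P}(u,v)=0$ otherwise; if $u\notin\mathrm{int}\,\mathbb K^0$, then $p_{\mathcal P}(u,u)=1$ and $p_{\mathcal P}(u,v)=0$ for $v\ne u$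 (absorbing boundary). A function $f:\mathbb K^0\to\mathbb R$ is harmonic for $(\mathbb K,p_{\mathcal P})$ if $f(v)=\sum_{u\sim v}p_{\mathcal P}(v,u)f(u)$ for every $v\in\mathrm{int}\,\mathbb K^0$.
   Formalization: The prescribed angles of overlaps are required to lie in [0, π/2]; for obtuse angles the claim can fail, because the conductances are unsigned (e.g. equal large circles centred on a non-Delaunay flower). *)

(* Defs.v *)
From HB Require Import structures.
From mathcomp Require Import all_boot all_order all_algebra.
From mathcomp Require Import finmap complex.
From mathcomp Require Import all_classical all_reals all_analysis.
Import Order.TTheory GRing.Theory Num.Theory.
Import numFieldNormedType.Exports.

Set Implicit Arguments.
Unset Strict Implicit.
Unset Printing Implicit Defensive.

Local Open Scope classical_set_scope.
Local Open Scope ring_scope.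

(** * Simplicial 2-complexes

    An abstract simplicial complex is given by the set [K] of its simplices,
    which are nonempty finite sets of vertices; every element of [V] is required
    to be a vertex, so that [V] plays the role of the vertex set K^0. *)

Record simplicial_2complex (V : choiceType) (K : set {fset V}) : Prop := {
  simplex_neq0 : ~ K fset0;
  simplex_sub : forall s t : {fset V},
    K t -> s != fset0 -> (s `<=` t)%fset -> K s;
  simplex_vertex : forall v : V, K [fset v]%fset;
  simplex_dim : forall s : {fset V}, K s -> (#|` s| <= 3)%N }.

Definition adj (V : choiceType) (K : set {fset V}) (u v : V) : Prop :=
  u != v /\ K [fset u; v]%fset.

Definition nbrs (V : choiceType) (K : set {fset V}) (u : V) : set V :=
  [set v | adj K u v].

Definition face (V : choiceType) (K : set {fset V}) (u v w : V) : Prop :=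
  [/\ u != v, v != w, w != u & K [fset u; v; w]%fset].

(* The boundary consists of the edges contained in only one face. *)
Definition boundary_edge (V : choiceType) (K : set {fset V}) (u v : V) : Prop :=
  adj K u v /\ exists! w, face K u v w.

Definition interior_vertex (V : choiceType) (K : set {fset V}) (v : V) : Prop :=
  forall u, ~ boundary_edge K v u.

(** * Triangulations of a disc *)

(* Points of the geometric realization are given by their barycentric
   coordinates.  On this set the topology of pointwise convergence is the one
   of the barycentric metric (the coordinates are nonnegative and add up to 1),
   which for a locally finite complex is also the weak topology. *)
Definition realization (R : realType) (V : choiceType) (K : set {fset V}) :
    set {ptws V -> R} :=
  [set b | (forall v, 0 <= b v) /\
     exists s : {fset V}, [/\ K s, forall v, v \notin s -> b v = 0
                            & \sum_(v <- s) b v = 1]].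

Definition homeomorphic (T U : topologicalType) (A : set T) (B : set U) : Prop :=
  exists (f : T -> U) (g : U -> T),
    [/\ {within A, continuous f}, {within B, continuous g},
        forall x, A x -> B (f x) /\ g (f x) = x
      & forall y, B y -> A (g y) /\ f (g y) = y].

(* Up to homeomorphism, discs with or without boundary are the sets lying
   between the open and the closed unit disc: the closed disc for the finite
   complexes, the open disc for the infinite ones without boundary, and the open
   disc together with some open arcs of the unit circle for the infinite ones
   with boundary. *)
Definition is_disc (R : realType) (D : set (R[i])^o) : Prop :=
  [set z : (R[i])^o | `|z| < 1] `<=` D /\ D `<=` [set z : (R[i])^o | `|z| <= 1].

Record triangulates_disc (R : realType) (V : choiceType) (K : set {fset V}) :
    Prop := {
  disc_complex : simplicial_2complex K;
  disc_pure : forall s : {fset V}, K s ->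
    exists t : {fset V}, [/\ K t, #|` t| = 3%N & (s `<=` t)%fset];
  disc_locally_finite : forall v : V, finite_set (nbrs K v);
  disc_homeo : exists D : set (R[i])^o,
    is_disc D /\ homeomorphic (realization K : set {ptws V -> R}) D }.

(* [pos u v w]: the face uvw is positively oriented when its vertices are listed
   in this order.  Positivity is invariant under cyclic permutations, each face
   is positive in exactly one of its two cyclic orders, and adjacent faces induce
   opposite directions on their common edge.  A triangulated disc has exactly two
   such orientations; complex conjugation exchanges them, so each of them is
   the orientation of the plane for a suitable embedding of the disc. *)
Record orientation (V : choiceType) (K : set {fset V}) (pos : V -> V -> V -> Prop) :
    Prop := {
  pos_face : forall u v w, pos u v w -> face K u v w;
  pos_cycle : forall u v w, pos u v w -> pos v w u;
  pos_total : forall u v w, face K u v w -> pos u v w \/ pos v u w;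
  pos_asym : forall u v w, pos u v w -> ~ pos v u w;
  pos_coherent : forall u v w w', pos u v w -> pos u v w' -> w = w' }.

(** * Circle packings *)

Record circles (R : realType) (V : choiceType) := Circles {
  circle_center : V -> R[i];
  circle_radius : V -> R }.

(* Euclidean distance, as an element of [R] rather than of [R[i]]. *)
Definition cdist (R : realType) (a b : R[i]) : R := Normc.normc (a - b).

Definition positive_triangle (R : realType) (a b c : R[i]) : Prop :=
  0 < complex.Im ((b - a)^*%C * (c - a)).

(* Overlap angles range over [0, pi/2]: 0 is external tangency, and pi/2 is
   orthogonality.  With obtuse angles a radical center may leave its triangle, and
   the unsigned conductances below would no longer make the centers harmonic. *)
Record circle_packing (R : realType) (V : choiceType) (K : set {fset V})
    (pos : V -> V -> V -> Prop) (theta : {fset V} -> R) (P : circles R V) :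
    Prop := {
  overlap_range : forall u v, adj K u v ->
    0 <= theta [fset u; v]%fset <= pi / 2;
  radius_gt0 : forall v, 0 < circle_radius P v;
  overlap_angle : forall u v, adj K u v ->
    cdist (circle_center P u) (circle_center P v) ^+ 2 =
      circle_radius P u ^+ 2 + circle_radius P v ^+ 2
      + 2 * circle_radius P u * circle_radius P v * cos (theta [fset u; v]%fset);
  positive_face : forall u v w, pos u v w ->
    positive_triangle (circle_center P u) (circle_center P v) (circle_center P w) }.

Definition power (R : realType) (V : choiceType) (P : circles R V) (v : V)
    (z : R[i]) : R :=
  cdist z (circle_center P v) ^+ 2 - circle_radius P v ^+ 2.

Definition radical_center (R : realType) (V : choiceType) (P : circles R V)
    (u v w : V) : R[i] :=
  xget 0 [set z | power P u z = power P v z /\ power P v z = power P w z].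

(** * The induced random walk *)

(* [w1] and [w2] are the third vertices of the two faces containing the edge uv
   (when there are two such faces); the value does not depend on which of them is
   chosen first. *)
Definition conductance (R : realType) (V : choiceType) (K : set {fset V})
    (P : circles R V) (u v : V) : R :=
  let w1 := xget u [set w | face K u v w] in
  let w2 := xget u [set w | face K u v w /\ w <> w1] in
  cdist (radical_center P u v w1) (radical_center P u v w2)
  / cdist (circle_center P u) (circle_center P v).

Definition walk (R : realType) (V : choiceType) (K : set {fset V})
    (P : circles R V) (u v : V) : R :=
  if `[< interior_vertex K u >] then
    if `[< adj K u v >] then
      conductance K P u v / \sum_(w \in nbrs K u) conductance K P u w
    else 0
  else if v == u then 1 else 0.

Definition harmonic_for (R : realType) (V : choiceType) (K : set {fset V})
    (p : V -> V -> R) (f : V -> R) : Prop :=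
  forall v, interior_vertex K v -> f v = \sum_(u \in nbrs K v) p v u * f u.

(* Main.v *)
Require Import Defs.
From HB Require Import structures.
From mathcomp Require Import all_boot all_order all_algebra.
From mathcomp Require Import finmap complex.
From mathcomp Require Import all_classical all_reals all_analysis.
From mathcomp Require Import ring lra.
Import Order.TTheory GRing.Theory Num.Theory.
Import numFieldNormedType.Exports.

Set Implicit Arguments.
Unset Strict Implicit.
Unset Printing Implicit Defensive.

Local Open Scope classical_set_scope.
Local Open Scope ring_scope.

(** The weights satisfy c(u,v) (S(v) - S(u)) = - i (z - z'), where z and z' are the
    radical centers of the faces to the left and to the right of the oriented edge
    uv.  Both points lie on the radical axis of the circles of u and v, which is
    perpendicular to S(v) - S(u) ([radical_axisE]); the modulus is right by
    definition of the conductance; so only the sense of the rotation is at stake,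
    namely that z is on the left of the line from S(u) to S(v), and z' on its
    right.  For overlap angles in [0, pi/2] this follows from an explicit formula
    ([cross_radical_center]) for the height of a radical center over a side, all of
    whose terms are nonnegative.

    When u is an interior vertex, the left vertex of an edge uv is the far end of
    another edge uw, and the face on the left of uv is the face on the right of uw.
    The map v |-> w permutes the neighbors of u ([left_vertex_bij]), so the radical
    centers on the left of the edges at u are those on their right, permuted, and
    the weighted sum of S(v) - S(u) vanishes.  This reindexing is combinatorial, so
    it is indifferent to how often the triangles wind around the center S(u).

    To pass from this balance to a weighted mean, the total conductance at u has to
    be nonzero.  A single conductance can vanish, but equality in the height
    formula then forces the circles of u and v to be tangent and those of u and w to
    be orthogonal, so that the next edge uw, not being tangent, has positive
    conductance ([conductance_sum_gt0]). *)

(** * Radical centers of positively oriented triangles *)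

(** Twice the signed area of the triangle abc; [positive_triangle] asks for its
    positivity, and divided by the length of ab it is the signed height of c over
    the oriented line ab. *)
Definition cross (R : realType) (a b c : R[i]) : R :=
  complex.Im ((b - a)^*%C * (c - a)).

Lemma crossE (R : realType) (a b c : R[i]) :
  cross a b c = (complex.Re b - complex.Re a) * (complex.Im c - complex.Im a)
              - (complex.Im b - complex.Im a) * (complex.Re c - complex.Re a).
Proof. by case: a b c => [? ?] [? ?] [? ?]; rewrite /cross /=; ring. Qed.

Lemma cdist_sqr (R : realType) (a b : R[i]) :
  cdist a b ^+ 2 = (complex.Re a - complex.Re b) ^+ 2
                 + (complex.Im a - complex.Im b) ^+ 2.
Proof.
case: a b => [a1 a2] [b1 b2]; rewrite /cdist /= sqr_sqrtr //.
by rewrite addr_ge0 ?sqr_ge0.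
Qed.

Lemma cdist_ge0 (R : realType) (a b : R[i]) : 0 <= cdist a b.
Proof. by case: a b => [? ?] [? ?]; rewrite /cdist /= sqrtr_ge0. Qed.

Lemma cdistC (R : realType) (a b : R[i]) : cdist a b = cdist b a.
Proof.
apply: (@pexpIrn _ 2); rewrite ?nnegrE ?cdist_ge0 // !cdist_sqr; ring.
Qed.

Section RadicalCenter.
Variables (R : realType) (V : choiceType) (P : circles R V).
Local Notation S := (circle_center P).
Local Notation r := (circle_radius P).

Lemma radical_center_swap (u v w : V) :
  radical_center P v u w = radical_center P u v w.
Proof.
congr xget; apply/seteqP; split=> z /= [e1 e2]; split; congruence.
Qed.

Lemma radical_center_rot (u v w : V) :
  radical_center P v w u = radical_center P u v w.
Proof.
congr xget; apply/seteqP; split=> z /= [e1 e2]; split; congruence.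
Qed.

(** Equal powers amount to a linear system whose matrix has the rows S(v) - S(u)
    and S(w) - S(u), with determinant the (positive) [cross] of the triangle; the
    solution is written down by Cramer's rule. *)
Lemma radical_center_power (u v w : V) : positive_triangle (S u) (S v) (S w) ->
  power P u (radical_center P u v w) = power P v (radical_center P u v w) /\
  power P v (radical_center P u v w) = power P w (radical_center P u v w).
Proof.
rewrite /positive_triangle -/(cross _ _ _) crossE => D0.
apply: (@xgetPex _ 0 [set z | power P u z = power P v z /\
   power P v z = power P w z]).
set p := complex.Re (S v) - complex.Re (S u) in D0.
set q := complex.Im (S v) - complex.Im (S u) in D0.
set s := complex.Re (S w) - complex.Re (S u) in D0.
set t := complex.Im (S w) - complex.Im (S u) in D0.
pose k := (p ^+ 2 + q ^+ 2 + r u ^+ 2 - r v ^+ 2) / 2.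
pose l := (s ^+ 2 + t ^+ 2 + r u ^+ 2 - r w ^+ 2) / 2.
pose D := p * t - q * s.
have Dn : D != 0 by exact: lt0r_neq0 D0.
pose X := (k * t - q * l) / D; pose Y := (p * l - s * k) / D.
have eX : p * X + q * Y = k by rewrite /X /Y /D; field.
have eY : s * X + t * Y = l by rewrite /X /Y /D; field.
exists (Complex (complex.Re (S u) + X) (complex.Im (S u) + Y)).
rewrite /= /power !cdist_sqr /=.
move: eX eY; rewrite /k /l /p /q /s /t; move=> eX eY; split; lra.
Qed.

(** The right-hand side does not involve z: the points of equal power form a line
    perpendicular to S(v) - S(u). *)
Lemma radical_axisE (u v : V) (z : R[i]) : power P u z = power P v z ->
  (complex.Re (S v) - complex.Re (S u)) * (complex.Re z - complex.Re (S u)) +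
  (complex.Im (S v) - complex.Im (S u)) * (complex.Im z - complex.Im (S u)) =
  (cdist (S u) (S v) ^+ 2 + r u ^+ 2 - r v ^+ 2) / 2.
Proof. by rewrite /power !cdist_sqr => h; lra. Qed.

(** Here cuv, cuw and cvw stand for the cosines of the overlap angles.  The
    formula is that of Cramer's rule, once the scalar products of the sides are
    expressed by radii and cosines; when the cosines lie in [0, 1], so that no
    cancellation occurs, it shows at a glance the sign of the left-hand side and
    when it vanishes. *)
Lemma cross_radical_center (u v w : V) (cuv cuw cvw : R) :
  positive_triangle (S u) (S v) (S w) ->
  cdist (S u) (S v) ^+ 2 = r u ^+ 2 + r v ^+ 2 + 2 * r u * r v * cuv ->
  cdist (S u) (S w) ^+ 2 = r u ^+ 2 + r w ^+ 2 + 2 * r u * r w * cuw ->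
  cdist (S v) (S w) ^+ 2 = r v ^+ 2 + r w ^+ 2 + 2 * r v * r w * cvw ->
  cross (S u) (S v) (radical_center P u v w) * cross (S u) (S v) (S w) =
  r u * r v * (r u * r v * (1 - cuv ^+ 2)
     + r w * (r v * (cuw + cvw * cuv) + r u * (cvw + cuw * cuv))).
Proof.
move=> tri euv euw evw; have [e1 e2] := radical_center_power tri.
have e3 := etrans e1 e2.
move: (radical_axisE e1) (radical_axisE e3); rewrite euv euw.
move: euv euw evw; rewrite !cdist_sqr !crossE.
set z := radical_center _ _ _ _.
set p := complex.Re (S v) - complex.Re (S u).
set q := complex.Im (S v) - complex.Im (S u).
set s := complex.Re (S w) - complex.Re (S u).
set t := complex.Im (S w) - complex.Im (S u).
set X := complex.Re z - _; set Y := complex.Im z - _.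
move=> euv euw evw k l.
have epq : p ^+ 2 + q ^+ 2 = r u ^+ 2 + r v ^+ 2 + 2 * r u * r v * cuv.
  by rewrite -euv /p /q; ring.
have est : p * s + q * t = r u ^+ 2 + r u * r v * cuv + r u * r w * cuw
    - r v * r w * cvw.
  by move: euv euw evw; rewrite /p /q /s /t; lra.
(* Gram form: p Y - q X times p t - q s, in terms of scalar products only. *)
transitivity ((p ^+ 2 + q ^+ 2) * (s * X + t * Y)
   - (p * s + q * t) * (p * X + q * Y)); first by ring.
by rewrite epq est k l; field.
Qed.

(** A vector (e, f) orthogonal to (a, b), and on its left, is (a, b) turned by a
    quarter turn and scaled by the ratio of the lengths c and d. *)
Lemma rotate_orthogonal (a b e f c d : R) : 0 < a ^+ 2 + b ^+ 2 ->
  a * e + b * f = 0 -> 0 <= a * f - b * e -> 0 <= c -> 0 <= d ->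
  c ^+ 2 = e ^+ 2 + f ^+ 2 -> d ^+ 2 = a ^+ 2 + b ^+ 2 ->
  c / d * a = f /\ c / d * b = - e.
Proof.
move=> d2 orth t0 c0 d0 ec ed.
have dp : 0 < d by rewrite lt0r d0 andbT; apply/eqP => dz; move: d2; rewrite -ed dz; lra.
have dn : d != 0 by rewrite gt_eqF.
(* The squares agree by Lagrange's identity, since the scalar product is 0. *)
have cd : c * d = a * f - b * e.
  apply: (@pexpIrn _ 2); rewrite ?nnegrE ?mulr_ge0 //.
  rewrite exprMn ec ed.
  transitivity ((a * e + b * f) ^+ 2 + (a * f - b * e) ^+ 2); first by ring.
  by rewrite orth; ring.
have -> : c / d = (a * f - b * e) / d ^+ 2 by rewrite -cd; field.
have dn2 : d ^+ 2 != 0 by rewrite expf_neq0.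
split; apply: (mulfI dn2); rewrite mulrA mulrCA mulrA mulfK // ed.
  transitivity (f * (a ^+ 2 + b ^+ 2) - b * (a * e + b * f)); first by ring.
  by rewrite orth; ring.
transitivity (- e * (a ^+ 2 + b ^+ 2) + a * (a * e + b * f)); first by ring.
by rewrite orth; ring.
Qed.

(** The dual edge, from the radical center on the right of uv to the one on the
    left, is c(u,v) times the edge turned counterclockwise by a right angle.  The
    right-hand face is listed as v, u, w', so that it is on the left of vu. *)
Lemma dual_edge_rotated (u v w w' : V) :
  positive_triangle (S u) (S v) (S w) -> positive_triangle (S v) (S u) (S w') ->
  0 <= cross (S u) (S v) (radical_center P u v w) ->
  0 <= cross (S v) (S u) (radical_center P v u w') ->
  let c := cdist (radical_center P u v w) (radical_center P v u w')
    / cdist (S u) (S v) in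
  c * (complex.Re (S v) - complex.Re (S u)) =
    complex.Im (radical_center P u v w) - complex.Im (radical_center P v u w') /\
  c * (complex.Im (S v) - complex.Im (S u)) =
    - (complex.Re (radical_center P u v w) - complex.Re (radical_center P v u w')).
Proof.
move=> tri tri' h h' c.
have [/radical_axisE e1 _] := radical_center_power tri.
have [/esym/radical_axisE e2 _] := radical_center_power tri'.
move: h h'; rewrite !crossE => h h'.
apply: rotate_orthogonal; rewrite ?cdist_ge0 ?cdist_sqr //; last by ring.
- rewrite lt0r addr_ge0 ?sqr_ge0 // andbT paddr_eq0 ?sqr_ge0 // !sqrf_eq0.
  apply/negP => /andP [/eqP p0 /eqP q0].
  by move: tri; rewrite /positive_triangle -/(cross _ _ _) crossE p0 q0; lra.
- lra.
- lra.
Qed.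

End RadicalCenter.

(** * The faces around an interior vertex *)

Section Links.
Variables (R : realType) (V : choiceType) (K : set {fset V}).
Variables (pos : V -> V -> V -> Prop).
Hypotheses (hK : triangulates_disc R K) (hpos : orientation K pos).

Lemma adjC u v : adj K u v -> adj K v u.
Proof. by rewrite /adj eq_sym fsetUC. Qed.

Lemma pos_adj u v w : pos u v w -> adj K u v.
Proof.
move=> /(pos_face hpos) [uv _ _ Kuvw]; split=> //.
apply: (simplex_sub (disc_complex hK)) Kuvw _ _.
  by apply/fset0Pn; exists u; rewrite !inE eqxx.
exact: fsubsetUl.
Qed.

Lemma pos_rot u v w : pos u v w -> pos w u v.
Proof. by move=> h; do 2!apply: (pos_cycle hpos). Qed.

Lemma pos_second_inj u v v' w : pos u v w -> pos u v' w -> v = v'.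
Proof. by move=> /pos_rot h /pos_rot; apply: pos_coherent hpos _ _ _ _ h. Qed.

(** The complex is pure: an edge is a facet of a simplex with three vertices. *)
Lemma edge_face u v : adj K u v -> exists w, face K u v w.
Proof.
move=> [uv Kuv]; have [t [Kt t3 sub]] := disc_pure hK Kuv.
have : #|` (t `\` [fset u; v])%fset| == 1%N.
  by rewrite cardfsDS // t3 cardfs2 uv.
move=> /cardfs1P [w tw].
have : w \in (t `\` [fset u; v])%fset by rewrite tw inE.
rewrite !inE negb_or => /andP [/andP [wu wv] _].
exists w; split; rewrite // 1?eq_sym //.
by rewrite -tw fsetUDl fsetDv fsetD0 (fsetUidPr _ _ sub).
Qed.

Lemma face_swap u v w : face K u v w -> face K v u w.
Proof.
by move=> [uv vw wu Kuvw]; split; rewrite 1?eq_sym // (fsetUC [fset v]%fset).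
Qed.

(** Coherence allows at most one face on each side of an edge, so an edge without
    a face on one side would lie in exactly one face, and be a boundary edge. *)
Lemma interior_edge u v : interior_vertex K u -> adj K u v ->
  exists w w', pos u v w /\ pos v u w'.
Proof.
move=> iu uv; have [w fw] := edge_face uv.
apply: contrapT => nww.
have [] := iu v; split=> //; exists w; split=> // w' fw'.
case: (pos_total hpos fw) (pos_total hpos fw') => pw [] pw'.
- exact: pos_coherent hpos _ _ _ _ pw pw'.
- by case: nww; exists w, w'.
- by case: nww; exists w', w.
- exact: pos_coherent hpos _ _ _ _ pw pw'.
Qed.

Lemma face_third u v w w' x : pos u v w -> pos v u w' ->
  face K u v x <-> x = w \/ x = w'.
Proof.
move=> pw pw'; split=> [/(pos_total hpos) [] px|[]->].
- by left; exact: pos_coherent hpos _ _ _ _ px pw.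
- by right; exact: pos_coherent hpos _ _ _ _ px pw'.
- exact: pos_face hpos _ _ _ pw.
- by apply: face_swap; exact: pos_face hpos _ _ _ pw'.
Qed.

(** The third vertices of the faces on either side of the oriented edge uv;
    coherence makes them unique, and at an interior vertex they exist, so that the
    default value u does not occur there. *)
Definition left_vertex (u v : V) : V := xget u [set w | pos u v w].
Definition right_vertex (u v : V) : V := xget u [set w | pos v u w].

Lemma left_vertexE u v w : pos u v w -> left_vertex u v = w.
Proof. by move=> h; apply: xget_unique => // y hy; exact: pos_coherent hpos _ _ _ _ hy h. Qed.

Lemma right_vertexE u v w : pos v u w -> right_vertex u v = w.
Proof. by move=> h; apply: xget_unique => // y hy; exact: pos_coherent hpos _ _ _ _ hy h. Qed.

Lemma interior_left_right u v : interior_vertex K u -> adj K u v ->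
  pos u v (left_vertex u v) /\ pos v u (right_vertex u v).
Proof.
move=> iu uv; have [w [w' [pw pw']]] := interior_edge iu uv.
by rewrite (left_vertexE pw) (right_vertexE pw').
Qed.

(** Turning counterclockwise around u; the inverse is [right_vertex u]. *)
Lemma left_vertex_bij u : interior_vertex K u ->
  set_bij (nbrs K u) (nbrs K u) (left_vertex u).
Proof.
move=> iu; split.
- move=> v /= uv; have [pw _] := interior_left_right iu uv.
  exact: adjC (pos_adj (pos_rot pw)).
- move=> v v' /set_mem /= uv /set_mem /= uv' e.
  have [pw _] := interior_left_right iu uv.
  have [pw' _] := interior_left_right iu uv'.
  by rewrite e in pw; exact: pos_second_inj pw pw'.
- move=> w /= uw; have [_ pv] := interior_left_right iu uw.
  exists (right_vertex u w); first exact: pos_adj (pos_cycle hpos pv).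
  exact: left_vertexE (pos_cycle hpos pv).
Qed.

(** * Conductances and harmonicity *)

Section Packing.
Variables (theta : {fset V} -> R) (P : circles R V).
Hypothesis hP : circle_packing K pos theta P.
Local Notation S := (circle_center P).
Local Notation r := (circle_radius P).

(** The two third vertices may be picked in either order; the distance between the
    radical centers is symmetric. *)
Lemma conductanceE u v w w' : pos u v w -> pos v u w' ->
  conductance K P u v =
  cdist (radical_center P u v w) (radical_center P v u w') / cdist (S u) (S v).
Proof.
move=> pw pw'; have fx x := face_third x pw pw'.
have ww' : w <> w' by move=> e; rewrite -e in pw'; exact: pos_asym hpos _ _ _ pw pw'.
rewrite /conductance (radical_center_swap P u v w'); congr (_ / _).
set w1 := xget u [set w | face K u v w].
set w2 := xget u [set w | face K u v w /\ w <> w1].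
have f1 : face K u v w1.
  by apply: (@xgetPex _ u [set x | face K u v x]); exists w; apply/fx; left.
have [f2 w21] : face K u v w2 /\ w2 <> w1.
  apply: (@xgetPex _ u [set x | face K u v x /\ x <> w1]).
  case: (proj1 (fx _) f1) => ->; [exists w'|exists w]; split=> //; try exact: nesym.
  - by apply/fx; right.
  - by apply/fx; left.
case: (proj1 (fx _) f1) (proj1 (fx _) f2) => e1 [] e2; rewrite e1 e2 // in w21 *.
exact: cdistC.
Qed.

Lemma cos_overlap u v : adj K u v -> 0 <= cos (theta [fset u; v]%fset) <= 1.
Proof.
move=> /(overlap_range hP) /andP [t0 t1]; rewrite cos_le1 andbT.
by apply: cos_ge0_pihalf; rewrite t1 andbT (le_trans _ t0) // oppr_le0 divr_ge0 ?pi_ge0.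
Qed.

(** The point can be on the side itself: this takes tangency along uv and
    orthogonality along the two other sides; the equality along uw is the one
    that matters for [conductance_sum_gt0]. *)
Lemma radical_center_left u v w : pos u v w ->
  0 <= cross (S u) (S v) (radical_center P u v w) /\
  (cross (S u) (S v) (radical_center P u v w) = 0 ->
     cos (theta [fset u; v]%fset) = 1 /\ cos (theta [fset u; w]%fset) = 0).
Proof.
move=> pw; have tri := positive_face hP pw.
have uv := pos_adj pw; have vw := pos_adj (pos_cycle hpos pw).
have uw := adjC (pos_adj (pos_rot pw)).
have := cross_radical_center tri (overlap_angle hP uv) (overlap_angle hP uw)
  (overlap_angle hP vw).
have /andP [C0 C1] := cos_overlap uv.
have /andP [B0 B1] := cos_overlap uw.
have /andP [A0 A1] := cos_overlap vw.
move: (radius_gt0 hP u) (radius_gt0 hP v) (radius_gt0 hP w).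
rewrite /positive_triangle -/(cross _ _ _) in tri.
move: tri A0 A1 B0 B1 C0 C1.
set D := cross _ _ (S w); set h := cross _ _ _.
set A := cos (theta [fset v; w]%fset); set B := cos (theta [fset u; w]%fset).
set C := cos (theta [fset u; v]%fset).
set a := r u; set b := r v; set c := r w.
move=> D0 A0 A1 B0 B1 C0 C1 a0 b0 c0 hD.
have ab0 : 0 < a * b by rewrite mulr_gt0.
have C2 : C ^+ 2 <= 1 by rewrite expr_le1.
have x0 : 0 <= a * b * (1 - C ^+ 2) by rewrite mulr_ge0 ?subr_ge0 // ltW.
have y0 : 0 <= B + A * C by rewrite addr_ge0 // mulr_ge0.
have z0 : 0 <= A + B * C by rewrite addr_ge0 // mulr_ge0.
have y0' : 0 <= b * (B + A * C) by rewrite mulr_ge0 // ltW.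
have z0' : 0 <= a * (A + B * C) by rewrite mulr_ge0 // ltW.
have w0 : 0 <= c * (b * (B + A * C) + a * (A + B * C)).
  by rewrite mulr_ge0 ?addr_ge0 // ltW.
split; first by rewrite -(pmulr_lge0 _ D0) hD mulr_ge0 ?addr_ge0 // ltW.
move=> h0; move/esym/eqP: hD; rewrite h0 mul0r mulf_eq0 gt_eqF //=.
rewrite (paddr_eq0 x0 w0) !mulf_eq0 !(gt_eqF a0) !(gt_eqF b0) !(gt_eqF c0) /=.
rewrite (paddr_eq0 y0' z0') mulf_eq0 (gt_eqF b0) /=.
rewrite (paddr_eq0 B0) ?mulr_ge0 //.
move=> /andP [/eqP C21 /andP [/andP [/eqP -> _] _]]; split=> //.
apply/eqP; rewrite -(@pexpr_eq1 _ C 2) // -subr_eq0 -oppr_eq0 opprB.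
exact/eqP.
Qed.

Lemma conductance_gradient u v : interior_vertex K u -> adj K u v ->
  conductance K P u v * (complex.Re (S v) - complex.Re (S u)) =
    complex.Im (radical_center P u v (left_vertex u v))
    - complex.Im (radical_center P v u (right_vertex u v)) /\
  conductance K P u v * (complex.Im (S v) - complex.Im (S u)) =
    - (complex.Re (radical_center P u v (left_vertex u v))
       - complex.Re (radical_center P v u (right_vertex u v))).
Proof.
move=> iu uv; have [pw pw'] := interior_left_right iu uv.
rewrite (conductanceE pw pw').
by apply: dual_edge_rotated; [exact: positive_face hP _ _ _ _ | exact: positive_face hP _ _ _ _
  | exact: (radical_center_left pw).1 | exact: (radical_center_left pw').1].
Qed.

Lemma conductance_ge0 u v : 0 <= conductance K P u v.
Proof. by rewrite divr_ge0 ?cdist_ge0. Qed.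

(** Zero conductance makes the two radical centers equal; they are on opposite
    sides of the line through S(u) and S(v), hence on it. *)
Lemma conductance_eq0 u v : interior_vertex K u -> adj K u v ->
  conductance K P u v = 0 ->
  cos (theta [fset u; v]%fset) = 1 /\ cos (theta [fset u; left_vertex u v]%fset) = 0.
Proof.
move=> iu uv c0; have [pw pw'] := interior_left_right iu uv.
have := conductance_gradient iu uv; rewrite c0 !mul0r => -[eI eR].
have [h0] := radical_center_left pw; apply.
have [h0' _] := radical_center_left pw'; move: h0 h0'.
by rewrite !crossE => h0 h0'; nra.
Qed.

(** Two successive edges at u cannot both have zero conductance: the first would
    make the circles of u and of its left vertex orthogonal, the second tangent. *)
Lemma conductance_sum_gt0 u : interior_vertex K u ->
  0 < \sum_(v \in nbrs K u) conductance K P u v.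
Proof.
move=> iu; have fin := disc_locally_finite hK u.
have [v uv] : exists v, adj K u v.
  have [t [Kt t3 sub]] := disc_pure hK (simplex_vertex (disc_complex hK) u).
  have [v] : exists v, v \in (t `\` [fset u])%fset.
    by apply/fset0Pn; rewrite -cardfs_gt0 cardfsDS // t3 cardfs1.
  rewrite !inE => /andP [vu vt]; exists v; split; first by rewrite eq_sym.
  apply: (simplex_sub (disc_complex hK)) Kt _ _.
    by apply/fset0Pn; exists u; rewrite !inE eqxx.
  by apply/fsubsetP => x; rewrite !inE => /orP [] /eqP -> //; rewrite -fsub1set.
have pos0 x : nbrs K u x -> 0 <= conductance K P u x by rewrite conductance_ge0.
rewrite lt0r fsumr_ge0 // andbT; apply/eqP => s0.
have z := pfsumr_eq0 fin pos0 s0.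
have [pw _] := interior_left_right iu uv.
have uw := adjC (pos_adj (pos_rot pw)).
have [_ c0] := conductance_eq0 iu uv (z _ uv).
have [c1 _] := conductance_eq0 iu uw (z _ uw).
by move/eqP: c1; rewrite c0 eq_sym oner_eq0.
Qed.

(** The face on the left of uv is on the right of the edge from u to the left
    vertex of uv. *)
Lemma dual_faces_sum (f : R[i] -> R) u : interior_vertex K u ->
  \sum_(v \in nbrs K u) f (radical_center P v u (right_vertex u v)) =
  \sum_(v \in nbrs K u) f (radical_center P u v (left_vertex u v)).
Proof.
move=> iu; rewrite (@reindex_fsbig _ _ _ _ _ (left_vertex u) _ _ _ (left_vertex_bij iu)).
apply: eq_fsbigr => v /set_mem /= uv; have [pw _] := interior_left_right iu uv.
by rewrite (right_vertexE (pos_rot pw)) 2!radical_center_rot.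
Qed.

Lemma dual_faces_sum0 (f : R[i] -> R) u : interior_vertex K u ->
  \sum_(v \in nbrs K u) (f (radical_center P u v (left_vertex u v))
    - f (radical_center P v u (right_vertex u v))) = 0.
Proof.
move=> iu; have fin := disc_locally_finite hK u.
have := dual_faces_sum f iu; rewrite !fsbig_finite // sumrB => ->.
exact: subrr.
Qed.

(** Multiplying by the total conductance, which is nonzero, turns the mean value
    property into the vanishing of the total flow out of u. *)
Lemma harmonic_of_balance (f : V -> R) :
  (forall u, interior_vertex K u ->
     \sum_(v \in nbrs K u) conductance K P u v * (f v - f u) = 0) ->
  harmonic_for K (walk K P) f.
Proof.
move=> bal u iu; have T0 := conductance_sum_gt0 iu.
have fin := disc_locally_finite hK u.
have := bal u iu; set T := \sum_(_ \in _) _ in T0.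
under eq_fsbigr do rewrite mulrBr.
rewrite fsbig_finite // sumrB -!fsbig_finite // -mulr_fsuml -/T.
move/eqP; rewrite subr_eq0 => /eqP e.
apply: (mulfI (lt0r_neq0 T0)); rewrite -e mulr_fsumr.
apply: eq_fsbigr => v /set_mem /= uv.
rewrite /walk !asboolT // -/T; field; exact: lt0r_neq0.
Qed.

End Packing.
End Links.

Theorem lemma4p3 (R : realType) (V : choiceType) (K : set {fset V})
    (pos : V -> V -> V -> Prop) (theta : {fset V} -> R) (P : circles R V)
    (hK : triangulates_disc R K) (hpos : orientation K pos)
    (hP : circle_packing K pos theta P) :
  harmonic_for K (walk K P) (fun v => complex.Re (circle_center P v)) /\
  harmonic_for K (walk K P) (fun v => complex.Im (circle_center P v)).
Proof.
split; apply: (harmonic_of_balance hK hpos hP) => u iu.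
  rewrite -[RHS](dual_faces_sum0 hK hpos P (@complex.Im R) iu).
  apply: eq_fsbigr => v /set_mem /= uv.
  by case: (conductance_gradient hK hpos hP iu uv).
rewrite -[RHS](dual_faces_sum0 hK hpos P (fun z => - complex.Re z) iu).
apply: eq_fsbigr => v /set_mem /= uv; rewrite -opprD.
by case: (conductance_gradient hK hpos hP iu uv).
Qed.
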